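(* Let $G=(V,E)$ be a finite graph with neither loops nor multiple edges. Let $q\in\{1,2,3,\dots\}$, $\Delta\in\mathbb R$, $K\in[0,\infty)$, and let $a,p$ satisfy $$p=1-e^{-2K},\qquad \frac{a}{1-a}=e^{-\Delta}.$$ Let $\mu$ be the probability measure on $\Sigma_q\times\Psi\times\Omega$ defined in the context (with parameters $a,p,q$). Then the marginal measure of $\mu$ on $\Sigma_q$ is the Blume--Capel--Potts (BCP) measure $\pi_q$ with parameters $K,\Delta,q$, and the marginal measure of $\mu$ on $\Psi\times\Omega$ is the diluted-random-cluster measure $\phi$ with parameters $a,p,q$.
   Context: Let $\Sigma_q=\{0,1,\dots,q\}^V$, $\Psi=\{0,1\}^V$, $\Omega=\{0,1\}^E$; $\delta_{u,v}$ is the Kronecker delta. BCP measure. For $\sigma\in\Sigma_q$ let $E_\sigma$ be the set of edges $e=\langle x,y\rangle\in E$ with $\sigma_x\neq0$ and $\sigma_y\ne 0$, and for $e=\langle x,y\rangle\in E$ let $\delta_e(\sigma)=\delta_{\sigma_x,\sigma_y}(1-\delta_{\sigma_x,0})$. The BCP measure with parameters $K,\Delta,q$ is the probability measure on $\Sigma_q$ given by $$\pi_q(\sigma)=\frac1{Z^{\rm BCP}}\exp\Big[-K|E_\sigma|+2K\sum_{e\in E}\delta_e(\sigma)+\Delta\sum_{x\in V}\delta_{\sigma_x,0}\Big],$$ where $Z^{\rm BCP}$ is the normalizing constant. Diluted-random-cluster measure. For $\psi\in\Psi$ let $V_\psi=\{x\in V:\psi_x=1\}$ and $E_\psi=\{\langle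 x,y\rangle\in E: x,y\in V_\psi\}$. For $\omega\in\Omega$ let $\eta(\omega)=\{e\in E:\omega_e=1\}$. Let $\Theta$ be the set of pairs $(\psi,\omega)\in\Psi\times\Omega$ with $\eta(\omega)\subseteq E_\psi$. For $\theta=(\psi,\omega)\in\Theta$ let $k(\theta)$ be the number of connected components of the graph $(V_\psi,\eta(\omega))$. Write $r=\sqrt{1-p}$. The diluted-random-cluster measure with parameters $a,p,q$ is the probability measure on $\Psi\times\Omega$ given by $$\phi(\theta)=\frac1{Z^{\rm DRC}}\,r^{|E_\psi|}q^{k(\theta)}\prod_{x\in V}\Big(\frac a{1-a}\Big)^{\psi_x}\prod_{e\in E_\psi}\Big(\frac p{1-p}\Big)^{\omega_e},\qquad \theta=(\psi,\omega)\in\Theta,$$ and $\phi(\theta)=0$ for $\theta\notin\Theta$, where $Z^{\rm DRC}$ is the normalizing constant. Coupling. Let $\mathcal S\subseteq\Sigma_q\times\Psi\times\Omega$ be the set of triples $(\sigma,\psi,\omega)$ such that: (i) $(\psi,\omega)\in\Theta$; (ii) $\psi_x=1-\delta_{\sigma_x,0}$ for all $x\in V$; (iii) for all $e=\langle x,y\rangle\in E$, if $\sigma_x\ne\sigma_y$ then $\omega_e=0$. Define $$\mu(\sigma,\psi,\omega)=\frac1Z\, r^{|E_\psi|}\prod_{x\in V}\Big(\frac a{1-a}\Big)^{\psi_x}\prod_{e\in E_\psi}\Big(\frac p{1-p}\Big)^{\omega_e}$$ if $(\sigma,\psi,\omega)\in\mathcal S$, and $\mu(\sigma,\psi,\omega)=0$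 otherwise, where $Z$ is the normalizing constant. *)

(* Defs.v *)
From HB Require Import structures.
From mathcomp Require Import all_boot all_order all_algebra.
From mathcomp Require Import reals sequences exp.

Set Implicit Arguments.
Unset Strict Implicit.
Unset Printing Implicit Defensive.

Import Order.TTheory GRing.Theory Num.Theory.

Local Open Scope ring_scope.

(* A measure on a finite set is identified with its mass function. *)
Section FiniteMeasures.

Variable R : realType.

Definition is_probability (T : finType) (m : {ffun T -> R}) : Prop :=
  (forall t, 0 <= m t) /\ \sum_t m t = 1.

Definition normalize (T : finType) (w : {ffun T -> R}) : {ffun T -> R} :=
  [ffun t => w t / \sum_s w s].

Definition marginal1 (S T : finType) (m : {ffun S * T -> R}) : {ffun S -> R} :=
  [ffun s => \sum_t m (s, t)].

Definition marginal2 (S T : finType) (m : {ffun S * T -> R}) : {ffun T -> R} :=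
  [ffun t => \sum_s m (s, t)].

Lemma normalize_probability (T : finType) (w : {ffun T -> R}) (t0 : T) :
  (forall t, 0 <= w t) -> 0 < w t0 -> is_probability (normalize w).
Proof.
move=> w0 wt0; have Z0 : 0 < \sum_s w s.
  by rewrite (bigD1 t0) //= ltr_pwDl // sumr_ge0.
split=> [t|]; first by rewrite ffunE divr_ge0 // ltW.
under eq_bigr do rewrite ffunE.
by rewrite -mulr_suml divff // gt_eqF.
Qed.

End FiniteMeasures.

(* The graph (V, E) has no multiple edges because E is a set of unordered
   pairs, and no loops because each of its members has two elements. *)
Definition simple_graph (V : finType) (E : {set {set V}}) : Prop :=
  {in E, forall e : {set V}, #|e| = 2%N}.

Definition edge (V : finType) (E : {set {set V}}) : finType :=
  {e : {set V} | e \in E}.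

Section Model.

Variables (R : realType) (V : finType) (E : {set {set V}}).

Definition spins (q : nat) : finType := {ffun V -> 'I_q.+1}.
Definition vconf : finType := {ffun V -> bool}.
Definition econf : finType := {ffun edge E -> bool}.

Implicit Types (psi : vconf) (omega : econf) (theta : vconf * econf).
Implicit Types (e : edge E) (K Delta a p : R) (q : nat).

Definition joins e (x y : V) : bool := val e == [set x; y].

Definition E_sigma q (sigma : spins q) : {set edge E} :=
  [set e | [exists x, exists y,
     [&& joins e x y, sigma x != ord0 & sigma y != ord0]]].

Definition delta_e q (sigma : spins q) e : bool :=
  [exists x, exists y,
     [&& joins e x y, sigma x == sigma y & sigma x != ord0]].

Definition BCP_weight K Delta q : {ffun spins q -> R} :=
  [ffun sigma : spins q =>
     expR (- K * #|E_sigma sigma|%:R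
           + 2 * K * (\sum_(e : edge E) (delta_e sigma e)%:R)
           + Delta * (\sum_(x : V) (sigma x == ord0)%:R))].

Definition BCP K Delta q : {ffun spins q -> R} :=
  normalize (BCP_weight K Delta q).

Definition V_psi psi : {set V} := [set x | psi x].

Definition E_psi psi : {set edge E} :=
  [set e | [exists x, exists y,
     [&& joins e x y, x \in V_psi psi & y \in V_psi psi]]].

Definition eta omega : {set edge E} := [set e | omega e].

Definition Theta : {set vconf * econf} :=
  [set theta | eta theta.2 \subset E_psi theta.1].

Definition open_rel omega : rel V :=
  fun x y => [exists e in eta omega, joins e x y].

(* For theta in Theta the set V_psi is closed under open_rel, so that n_comp
   does count the components of the graph (V_psi, eta omega); the value at
   other theta is never used. *)
Definition k_comp theta : nat := n_comp (open_rel theta.2) (V_psi theta.1).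

(* The factor common to the diluted-random-cluster measure and the coupling. *)
Definition dilute_weight a p theta : R :=
  Num.sqrt (1 - p) ^+ #|E_psi theta.1|
  * (\prod_(x : V) (a / (1 - a)) ^+ theta.1 x)
  * (\prod_(e in E_psi theta.1) (p / (1 - p)) ^+ theta.2 e).

Definition DRC_weight a p q : {ffun vconf * econf -> R} :=
  [ffun theta => if theta \in Theta
                 then q%:R ^+ k_comp theta * dilute_weight a p theta else 0].

Definition DRC a p q : {ffun vconf * econf -> R} := normalize (DRC_weight a p q).

Definition compatible q : {set spins q * (vconf * econf)} :=
  [set t : spins q * (vconf * econf) |
    [&& t.2 \in Theta,
        [forall x, t.2.1 x == (t.1 x != ord0)]
      & [forall e, forall x, forall y,
           joins e x y && (t.1 x != t.1 y) ==> ~~ t.2.2 e]]].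

Definition coupling_weight a p q : {ffun spins q * (vconf * econf) -> R} :=
  [ffun t : spins q * (vconf * econf) =>
     if t \in compatible q then dilute_weight a p t.2 else 0].

Definition coupling a p q : {ffun spins q * (vconf * econf) -> R} :=
  normalize (coupling_weight a p q).

Lemma open_rel_closed theta :
  theta \in Theta -> closed (open_rel theta.2) (mem (V_psi theta.1)).
Proof.
rewrite inE => /subsetP sub x y /existsP[e /andP[/sub]].
rewrite inE => /existsP[u /existsP[v /and3P[/eqP uv uV vV]]] /eqP xy.
have eV z : z \in val e -> z \in V_psi theta.1.
  by rewrite uv !inE => /orP[] /eqP->; [move: uV | move: vV]; rewrite inE.
by rewrite !eV // xy !inE eqxx ?orbT.
Qed.

Lemma open_rel_connect_sym omega : connect_sym (open_rel omega).
Proof.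
apply: sym_connect_sym => x y; apply: eq_existsb => e.
by rewrite /joins setUC.
Qed.

Lemma dilute_weight_ge0 a p theta :
  0 < a < 1 -> 0 <= p < 1 -> 0 <= dilute_weight a p theta.
Proof.
move=> /andP[a0 a1] /andP[p0 p1]; rewrite /dilute_weight.
have ha : 0 <= a / (1 - a) by rewrite divr_ge0 ?subr_ge0 // ltW.
have hp : 0 <= p / (1 - p) by rewrite divr_ge0 ?subr_ge0 // ltW.
by rewrite !mulr_ge0 ?exprn_ge0 ?sqrtr_ge0 ?prodr_ge0 // => *;
  rewrite exprn_ge0.
Qed.

Let theta0 : vconf * econf := ([ffun=> false], [ffun=> false]).

Let theta0_Theta : theta0 \in Theta.
Proof. by rewrite inE; apply/subsetP => e; rewrite inE ffunE. Qed.

Let dilute_weight0 a p : 0 <= p < 1 -> 0 < dilute_weight a p theta0.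
Proof.
move=> /andP[_ p1]; rewrite /dilute_weight.
rewrite big1 ?mulr1 => [|x _]; last by rewrite ffunE.
rewrite big1 ?mulr1 => [|e _]; last by rewrite ffunE.
by rewrite exprn_gt0 // sqrtr_gt0 subr_gt0.
Qed.

Lemma BCP_probability K Delta q : is_probability (BCP K Delta q).
Proof.
have w_gt0 t : 0 < BCP_weight K Delta q t by rewrite ffunE expR_gt0.
by apply: (@normalize_probability _ _ _ [ffun=> ord0]) => // t; exact: ltW.
Qed.

Lemma DRC_probability a p q : 0 < a < 1 -> 0 <= p < 1 -> (0 < q)%N ->
  is_probability (DRC a p q).
Proof.
move=> a01 p01 q0; apply: (@normalize_probability _ _ _ theta0) => [t|].
  by rewrite ffunE; case: ifP => // _; rewrite mulr_ge0 ?exprn_ge0 ?ler0n ?dilute_weight_ge0.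
by rewrite ffunE theta0_Theta mulr_gt0 ?dilute_weight0 // exprn_gt0 ?ltr0n.
Qed.

Lemma coupling_probability a p q : 0 < a < 1 -> 0 <= p < 1 ->
  is_probability (coupling a p q).
Proof.
move=> a01 p01.
apply: (@normalize_probability _ _ _ ([ffun=> ord0], theta0)) => [t|].
  by rewrite ffunE; case: ifP => // _; rewrite dilute_weight_ge0.
rewrite ffunE ifT ?dilute_weight0 // inE theta0_Theta /=.
apply/andP; split; first by apply/forallP => x; rewrite !ffunE.
by do 3 apply/forallP => ?; rewrite !ffunE eqxx andbF.
Qed.

End Model.

Lemma parameters_range (R : realType) (Delta K a p : R) : 0 <= K ->
  p = 1 - expR (- 2 * K) -> a / (1 - a) = expR (- Delta) ->
  0 < a < 1 /\ 0 <= p < 1.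
Proof.
move=> K0 -> ha; split; last first.
  rewrite subr_ge0 ltrBlDr ltrDl expR_gt0 andbT -[leRHS]expR0 ler_expR.
  by rewrite mulNr oppr_le0 mulr_ge0.
have b0 : 0 < a / (1 - a) by rewrite ha expR_gt0.
have a1 : 1 - a != 0.
  by apply: contraTneq b0 => ->; rewrite invr0 mulr0 ltxx.
have aE : a = a / (1 - a) * (1 - a) by rewrite divfK.
have aB : (1 - a) * (1 + a / (1 - a)) = 1.
  by rewrite mulrDr mulr1 (mulrC (1 - a)) -aE subrK.
have a1_gt0 : 0 < 1 - a.
  by rewrite -(pmulr_lgt0 _ (addr_gt0 ltr01 b0)) aB.
by rewrite aE mulr_gt0 //= -aE -subr_gt0.
Qed.

Arguments BCP {R V} E K Delta q.
Arguments DRC {R V} E a p q.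
Arguments coupling {R V} E a p q.

(* Main.v *)
(* Both marginals of the unnormalised coupling weight are computed up to a
   constant factor.  Summing over the spins at a fixed (psi, omega) counts the
   assignments of one of q nonzero spins to each open component, which gives
   q ^ k.  Summing over (psi, omega) at fixed spins forces psi, and each edge
   whose ends carry the same nonzero spin contributes 1 / (1 - p) = e ^ (2 K);
   the result is e ^ (- Delta |V|) times the BCP weight. *)

Require Import Defs.
From HB Require Import structures.
From mathcomp Require Import all_boot all_order all_algebra.
From mathcomp Require Import reals sequences exp.
From mathcomp Require Import ring.

Set Implicit Arguments.
Unset Strict Implicit.
Unset Printing Implicit Defensive.

Import Order.TTheory GRing.Theory Num.Theory.

Local Open Scope ring_scope.

(** Summing out a coordinate keeps the total mass, so both sides are divided by the same
    constant. *)
Lemma marginal1_normalize (R : realType) (S T : finType)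
    (w : {ffun S * T -> R}) :
  marginal1 (normalize w) = normalize (marginal1 w).
Proof.
apply/ffunP => s; rewrite !ffunE.
have -> : \sum_s marginal1 w s = \sum_u w u.
  under eq_bigr do rewrite ffunE.
  by rewrite pair_bigA; apply: eq_bigr => -[].
by rewrite mulr_suml; apply: eq_bigr => t _; rewrite ffunE.
Qed.

Lemma marginal2_normalize (R : realType) (S T : finType)
    (w : {ffun S * T -> R}) :
  marginal2 (normalize w) = normalize (marginal2 w).
Proof.
apply/ffunP => t; rewrite !ffunE.
have -> : \sum_t marginal2 w t = \sum_u w u.
  under eq_bigr do rewrite ffunE.
  by rewrite exchange_big pair_bigA; apply: eq_bigr => -[].
by rewrite mulr_suml; apply: eq_bigr => s _; rewrite ffunE.
Qed.

(** Absorbs the factor [expR (- Delta * #|V|%:R)] by which the spin marginal of the coupling weight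
    differs from the BCP weight. *)
Lemma normalize_scale (R : realType) (T : finType) (c : R)
    (w : {ffun T -> R}) :
  c != 0 -> normalize [ffun t => c * w t] = normalize w.
Proof.
move=> c0; apply/ffunP => t; rewrite !ffunE.
under eq_bigr do rewrite ffunE.
by rewrite -mulr_sumr -mulf_div divff // mul1r.
Qed.

(* Such a function is determined by its values, other than c0, at the roots of
   the components in A. *)
Lemma card_component_colorings (T C : finType) (e : rel T) (A : {pred T})
    (c0 : C) : connect_sym e -> closed e A ->
  #|[set s : {ffun T -> C} | [forall x, (s x != c0) == (x \in A)]
      & [forall x, forall y, e x y ==> (s x == s y)]]|
  = (#|C|.-1 ^ n_comp e A)%N.
Proof.
move=> sym_e clA.
have rootA x : (fingraph.root e x \in A) = (x \in A).
  by rewrite (closed_connect clA (connect_root e x)).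
pose D := [predI roots e & A].
pose g (f : {ffun T -> C}) : {ffun T -> C} := [ffun x => f (fingraph.root e x)].
pose B := [set f in pffun_on c0 D (predC1 c0)].
have BP f x : f \in B -> (f x != c0) = (x \in D).
  rewrite inE => /pffun_onP[/subsetP supf imf].
  apply/idP/idP => [fx|Dx]; first by apply: supf; rewrite inE.
  by apply: imf; apply/imageP; exists x.
have <- : #|B| = (#|C|.-1 ^ n_comp e A)%N.
  (* By definition [n_comp e A] is the size of [D], so only the number of colours other than [c0]
     remains to be found. *)
  rewrite cardsE card_pffun_on; congr (_ ^ _)%N.
    by rewrite cardC1.
have -> : [set s : {ffun T -> C} | [forall x, (s x != c0) == (x \in A)]
      & [forall x, forall y, e x y ==> (s x == s y)]] = g @: B.
  apply/setP => s; rewrite inE; apply/andP/imsetP => [[/forallP sA /forallP se]|].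
    have sroot x : s (fingraph.root e x) = s x.
      have /connectP[l + ->] := connect_root e x.
      elim: l x => //= y l IHl x /andP[exy /IHl ->].
      by have /forallP/(_ y) := se x; rewrite exy => /eqP.
    exists [ffun x => if x \in D then s x else c0].
      rewrite inE; apply/pffun_onP; split.
        by apply/subsetP => x; rewrite inE ffunE; case: ifP; rewrite ?eqxx.
      move=> _ /imageP[x Dx ->]; rewrite ffunE Dx inE (eqP (sA x)).
      by case/andP: Dx.
    apply/ffunP => x; rewrite !ffunE inE /= rootA.
    rewrite [_ \in roots e]roots_root //= -(eqP (sA x)) sroot.
    by case: eqP.
  move=> [f fB ->]; split; apply/forallP => x.
    by rewrite ffunE BP // inE /= rootA [_ \in roots e]roots_root.
  apply/forallP => y; apply/implyP => exy; rewrite !ffunE.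
  by rewrite (fingraph.rootP sym_e (connect1 exy)).
(* [g] is injective on [B]: a vertex of [D] is its own root, so [g f] agrees with [f] there, and off
   [D] every member of [B] equals [c0]. *)
rewrite card_in_imset // => f1 f2 f1B f2B /ffunP f12.
apply/ffunP => x; have [Dx|Dx] := boolP (x \in D).
  by have /andP[/eqP rx _] := Dx; have := f12 x; rewrite !ffunE rx.
have := BP _ x f1B; have := BP _ x f2B; rewrite (negbTE Dx).
by move=> /negbFE/eqP-> /negbFE/eqP->.
Qed.

Section Model.

Variables (R : realType) (V : finType) (E : {set {set V}}) (q : nat).

Implicit Types (s : spins V q) (psi : vconf V) (omega : econf E).

Definition occupation s : vconf V := [ffun x => s x != ord0].

(** [delta_e] asks for some naming of the ends of an edge, [compatible] for all namings; every
    naming lists the same pair, so the two notions of agreement match. *)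
Lemma joins_eq_spin s (e : edge E) (x y u v : V) :
  joins e x y -> joins e u v -> s x = s y -> s u = s v.
Proof.
move=> /eqP exy /eqP euv sxy.
have mem z : z \in val e -> s z = s y.
  by rewrite exy !inE => /orP[] /eqP->.
by rewrite !mem // euv !inE eqxx ?orbT.
Qed.

Lemma E_psi_occupation s : E_psi E (occupation s) = E_sigma E s.
Proof.
apply/setP => e; rewrite !inE; apply: eq_existsb => x.
by apply: eq_existsb => y; rewrite !inE !ffunE.
Qed.

(** Once [psi] is forced, [Theta] makes the ends of open edges nonzero and the third condition makes
    them equal. Together these constrain each edge separately, so the sum over [omega] can
    factorise. *)
Lemma compatibleE s psi omega :
  ((s, (psi, omega)) \in compatible E q) =
  (psi == occupation s) && [forall e, omega e ==> delta_e s e].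
Proof.
rewrite inE /= andbCA.
have -> : [forall x, psi x == (s x != ord0)] = (psi == occupation s).
  apply/forallP/eqP => [h|-> x]; last by rewrite ffunE.
  by apply/ffunP => x; rewrite ffunE (eqP (h x)).
have [->/=|//] := eqVneq psi; rewrite inE /= E_psi_occupation.
apply/andP/forallP => [[/subsetP sub /forallP h] e|h].
  apply/implyP => oe; have : e \in E_sigma E s by apply: sub; rewrite inE.
  rewrite inE => /existsP[x /existsP[y /and3P[exy sx sy]]].
  apply/existsP; exists x; apply/existsP; exists y; rewrite exy sx andbT /=.
  have /forallP/(_ x)/forallP/(_ y) := h e.
  by rewrite exy oe implybF negbK.
split.
  apply/subsetP => e; rewrite !inE => oe.
  have := h e; rewrite oe => /existsP[x /existsP[y /and3P[exy /eqP sxy sx]]].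
  apply/existsP; exists x; apply/existsP; exists y.
  by rewrite exy -sxy sx.
apply/forallP => e; apply/forallP => u; apply/forallP => v.
apply/implyP => /andP[euv]; apply: contra => oe.
have := h e; rewrite oe => /existsP[x /existsP[y /and3P[exy /eqP sxy _]]].
by apply/eqP; exact: joins_eq_spin exy euv sxy.
Qed.

Lemma delta_e_E_sigma s (e : edge E) : delta_e s e -> e \in E_sigma E s.
Proof.
move=> /existsP[x /existsP[y /and3P[exy /eqP sxy sx]]].
rewrite inE; apply/existsP; exists x; apply/existsP; exists y.
by rewrite exy -sxy sx.
Qed.

(* Given the spins, each edge with [delta_e] is independently open or closed,
   contributing 1 + p / (1 - p), and every other edge is closed. *)
Lemma marginal1_coupling_weight (a p : R) s : p != 1 ->
  marginal1 (coupling_weight E a p q) s =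
  Num.sqrt (1 - p) ^+ #|E_sigma E s|
  * (\prod_(x : V) (a / (1 - a)) ^+ (s x != ord0))
  * (\prod_(e : edge E) (1 - p)^-1 ^+ delta_e s e).
Proof.
move=> p1; rewrite ffunE.
transitivity (\sum_omega coupling_weight E a p q (s, (occupation s, omega))).
  transitivity (\sum_psi \sum_omega coupling_weight E a p q (s, (psi, omega))).
    by rewrite pair_bigA; apply: eq_bigr => -[].
  rewrite (bigD1 (occupation s)) //= [X in _ + X]big1 ?addr0 // => psi psiN.
  by apply: big1 => omega _; rewrite ffunE compatibleE (negbTE psiN).
(* The weight of [e] in state [b]. The multiplicity [delta_e s e] annihilates forbidden open edges,
   so the product of [F] vanishes on incompatible [omega]. *)
pose F (e : edge E) (b : bool) : R := if b then p / (1 - p) *+ delta_e s e else 1.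
have Fsum (e : edge E) : (1 - p)^-1 ^+ delta_e s e = \sum_b F e b.
  rewrite big_bool /F /=; case: delta_e; last by rewrite mulr0n add0r.
  rewrite mulr1n expr1 -[X in _ = _ + X](@divff _ (1 - p)) ?subr_eq0 1?eq_sym //.
  by rewrite -mulrDl subrKC div1r.
rewrite (eq_bigr _ (fun e _ => Fsum e)) bigA_distr_bigA mulr_sumr /=.
apply: eq_bigr => omega _; rewrite ffunE compatibleE eqxx /=.
case: ifPn => [/forallP h|/forallPn[e]]; last first.
  rewrite negb_imply => /andP[oe de].
  by rewrite (bigD1 e) //= /F oe (negbTE de) mul0r mulr0.
rewrite /dilute_weight /= E_psi_occupation; congr (_ * _ * _).
  by apply: eq_bigr => x _; rewrite ffunE.
(* The product extends from [E_sigma] to all edges: closed edges contribute 1, and open ones satisfy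
   [delta_e], hence lie in [E_sigma]. *)
rewrite big_mkcond; apply: eq_bigr => e _; rewrite /F.
have := h e; case: (omega e) => /= [de|_]; last by rewrite if_same.
by rewrite de delta_e_E_sigma.
Qed.

(** Compatible spins are the component colourings of [V_psi] with [ord0] as the colour outside;
    ['I_q.+1] has [q] other colours. *)
Lemma card_compatible (theta : vconf V * econf E) : theta \in Theta E ->
  #|[set s | (s, theta) \in compatible E q]| = (q ^ k_comp theta)%N.
Proof.
move=> thT; have := @card_component_colorings V 'I_q.+1 (open_rel theta.2)
  (mem (V_psi theta.1)) ord0 (open_rel_connect_sym _) (open_rel_closed thT).
rewrite card_ord /= => <-; apply: eq_card => s; rewrite [LHS]inE [RHS]inE.
rewrite inE thT /=; congr andb.
  by apply: eq_forallb => x; rewrite inE eq_sym.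
apply/forallP/forallP => [h x|h e].
  apply/forallP => y; apply/implyP => /existsP[e /andP[oe exy]].
  have /forallP/(_ x)/forallP/(_ y) := h e; rewrite inE in oe.
  by rewrite exy oe implybF negbK.
apply/forallP => x; apply/forallP => y; apply/implyP => /andP[exy].
apply: contra => oe; have /forallP/(_ y)/implyP := h x; apply.
by apply/existsP; exists e; rewrite inE oe.
Qed.

Lemma marginal2_coupling_weight (a p : R) :
  marginal2 (coupling_weight E a p q) = DRC_weight E a p q.
Proof.
apply/ffunP => theta; rewrite !ffunE.
under eq_bigr do rewrite ffunE /=.
case: ifPn => [thT|thN]; last first.
  by apply: big1 => s _; rewrite inE (negbTE thN).
rewrite -natrX -card_compatible // -big_mkcond sumr_const mulr_natl.
by congr (_ *+ _); apply: eq_card => s; rewrite inE.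
Qed.

End Model.

Theorem theorem3p7 (R : realType) (V : finType) (E : {set {set V}})
    (hE : simple_graph E) (q : nat) (hq : (1 <= q)%N)
    (Delta K a p : R) (hK : 0 <= K)
    (hp : p = 1 - expR (- 2 * K))
    (ha : a / (1 - a) = expR (- Delta)) :
  marginal1 (coupling E a p q) = BCP E K Delta q /\
  marginal2 (coupling E a p q) = DRC E a p q.
Proof.
split; last by rewrite /coupling marginal2_normalize marginal2_coupling_weight.
rewrite /coupling marginal1_normalize.
have p1E : 1 - p = expR (- 2 * K) by rewrite hp opprB addrC subrK.
have p1 : p != 1 by rewrite eq_sym -subr_eq0 p1E gt_eqF ?expR_gt0.
have rE : Num.sqrt (1 - p) = expR (- K).
  rewrite p1E mulNr mulr2n mulrDl mul1r opprD expRD -expr2.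
  by rewrite sqrtr_sqr ger0_norm ?expR_ge0.
have c0 : expR (- Delta * #|V|%:R) != 0 by rewrite gt_eqF ?expR_gt0.
rewrite /BCP -(normalize_scale (BCP_weight E K Delta q) c0); congr normalize.
apply/ffunP => s; rewrite marginal1_coupling_weight // !ffunE rE p1E ha.
rewrite -expRN.
have prodE (I : finType) (b : R) (P : pred I) :
    \prod_i expR b ^+ P i = expR (b * \sum_i (P i)%:R).
  by rewrite mulr_sumr expR_sum; apply: eq_bigr => i _; rewrite expRM_natr.
rewrite !prodE -expRM_natr -!expRD; congr expR.
(* Trades [- Delta] per occupied vertex for [Delta] per vacant one, which produces the constant
   [- Delta * #|V|%:R]. *)
have -> : \sum_x (s x != ord0)%:R = #|V|%:R - \sum_x (s x == ord0)%:R :> R.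
  rewrite -sum1_card natr_sum -sumrB; apply: eq_bigr => x _.
  by case: eqP; rewrite ?subrr ?subr0.
by ring.
Qed.
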